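(* Let $A\in\mathbb{C}^{n\times n}$, let $\widehat V\in\mathbb{C}^{n\times n}$ be invertible, let $\widehat W\in\mathbb{C}^{n\times n}$ be arbitrary, and let $\widehat D\in\mathbb{C}^{n\times n}$ be diagonal. Define $$R:=A\widehat V-\widehat V\widehat D,\qquad \Delta:=\widehat W^{\mathrm H}\widehat V-I,\qquad Y_\star:=\widehat V^{-1}R,\qquad Y_W:=\widehat W^{\mathrm H}R,$$ $$\widetilde D_\star=\mathrm{diag}(\widetilde d_{\star,1},\dots,\widetilde d_{\star,n}):=\widehat D+\mathrm{diag}(Y_\star),\qquad \widetilde D=\mathrm{diag}(\widetilde d_1,\dots,\widetilde d_n):=\widehat D+\mathrm{diag}(Y_W).$$ Assume $\gamma:=\mathrm{sep}(\widetilde D_\star)>0$, put $\eta:=\|Y_W-Y_\star\|_F$, and assume $\eta\le\gamma/4$. Let $\widetilde E_\star=[\widetilde e^{(\star)}_{ij}]$ be given by $$\widetilde e^{(\star)}_{ii}=0,\qquad \widetilde e^{(\star)}_{ij}=\frac{(Y_\star)_{ij}}{\widetilde d_{\star,j}-\widetilde d_{\star,i}}\quad(i\ne j).$$ Let $(\widetilde V,\widetilde W,\widetilde D)$ be the output of the left-right refinement algorithm described in the context, executed in exact arithmetic and in its simple-eigenvalue branch, and let $\widetilde E_W=[\widetilde e^{(W)}_{ij}]$ be the right-update matrix computed by it, that is, $$\widetilde e^{(W)}_{ii}=0,\qquad \widetilde e^{(W)}_{ij}=\frac{(Y_W)_{ij}}{\widetilde d_j-\widetilde d_i}\quad(i\ne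 j).$$ Then: 1. $\mathrm{sep}(\widetilde D)\ge\gamma/2$. 2. $\displaystyle \|\widetilde E_W-\widetilde E_\star\|_F\le\left(\frac{2}{\gamma}+\frac{4\|Y_\star\|_F}{\gamma^2}\right)\eta.$ 3. $\displaystyle \|\widehat V^{-1}(A\widetilde V-\widetilde V\widetilde D)\|_F\le\eta+\frac{2(\|Y_\star\|_F+\eta)^2}{\gamma}.$ 4. For any submultiplicative matrix norm $\|\cdot\|$ on $\mathbb{C}^{n\times n}$, $\displaystyle \|\widetilde W^{\mathrm H}\widetilde V-I\|\le(\|\widetilde E_W\|+\|\Delta\|)^2+(\|\widetilde E_W\|+\|\Delta\|)^3.$ Moreover, if $\|\Delta\|_2=\mathcal{O}(\|Y_\star\|_F)$, then both the updated right residual $\|\widehat V^{-1}(A\widetilde V-\widetilde V\widetilde D)\|_F$ and the updated biorthogonality error $\|\widetilde W^{\mathrm H}\widetilde V-I\|$ are $\mathcal{O}(\|Y_\star\|_F^2)$. Explicitly: for fixed $n$, a fixed submultiplicative norm $\|\cdot\|$, and any constants $C>0$ and $\gamma_0>0$, there exist $K,\varepsilon>0$ such that for all $A,\widehat V,\widehat W,\widehat D\in\mathbb{C}^{n\times n}$ with $\widehat V$ invertible and $\widehat D$ diagonal for which the quantities $Y_\star=\widehat V^{-1}(A\widehat V-\widehat V\widehat D)$, $Y_W=\widehat W^{\mathrm H}(A\widehat V-\widehat V\widehat D)$, $\Delta=\widehat W^{\mathrm H}\widehat V-I$, $\gamma=\mathrm{sep}(\widehat D+\mathrm{diag}(Y_\star))$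 and $\eta=\|Y_W-Y_\star\|_F$ satisfy $\eta\le\gamma/4$, $\gamma\ge\gamma_0$, $\|\Delta\|_2\le C\|Y_\star\|_F$ and $\|Y_\star\|_F\le\varepsilon$, and for which the left-right refinement algorithm described in the context, executed in exact arithmetic, takes its simple-eigenvalue branch and returns $(\widetilde V,\widetilde W,\widetilde D)$, both quantities $\|\widehat V^{-1}(A\widetilde V-\widetilde V\widetilde D)\|_F$ and $\|\widetilde W^{\mathrm H}\widetilde V-I\|$ are at most $K\|Y_\star\|_F^2$.
   Context: The superscript $\mathrm H$ denotes the conjugate transpose, $\|\cdot\|_F$ the Frobenius norm, and $\|\cdot\|_2$ the spectral norm. For a square matrix $M$, $\mathrm{diag}(M)$ is the diagonal matrix with the same diagonal entries as $M$. For a diagonal matrix $D=\mathrm{diag}(d_1,\dots,d_n)$ with $n\ge2$, $\mathrm{sep}(D):=\min_{i\ne j}|d_i-d_j|$. A matrix norm is submultiplicative if $\|XY\|\le\|X\|\,\|Y\|$ for all $X,Y$. Left-right refinement algorithm (the ''$W$-method''). Input: $A\in\mathbb{C}^{n\times n}$, invertible $\widehat V\in\mathbb{C}^{n\times n}$, $\widehat W\in\mathbb{C}^{n\times n}$, diagonal $\widehat D=\mathrm{diag}(\widehat d_1,\dots,\widehat d_n)$, and a chosen threshold $\tau>0$. (1) $R\gets A\widehat V-\widehat V\widehat D$. (2) $Y\gets\widehat W^{\mathrm H}R$. (3) $\widetilde d_i\gets\widehat d_i+y_{ii}$ for $i=1,\dots,n$. (4) If $\min_{i\ne j}|\widetilde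 d_i-\widetilde d_j|<\tau$, leave this algorithm (a separate procedure for clustered eigenvalues is used instead). Otherwise the simple-eigenvalue branch is taken and the algorithm continues. (5) $\widetilde e_{ii}\gets0$, and $\widetilde e_{ij}\gets y_{ij}/(\widetilde d_j-\widetilde d_i)$ for $i\ne j$; $\widetilde E\gets[\widetilde e_{ij}]$. (6) $F^{\mathrm H}\gets I-\widehat W^{\mathrm H}\widehat V-\widetilde E$. (7) $\widetilde V\gets\widehat V(I+\widetilde E)$, $\widetilde W\gets\widehat W(I+F)$, $\widetilde D\gets\mathrm{diag}(\widetilde d_1,\dots,\widetilde d_n)$. (8) Return $(\widetilde V,\widetilde W,\widetilde D)$. *)

(* Defs.v *)
From mathcomp Require Export all_boot all_order all_algebra.
From mathcomp Require Export complex.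
From mathcomp Require Export boolp classical_sets reals.

Set Implicit Arguments.
Unset Strict Implicit.
Unset Printing Implicit Defensive.

Import Order.TTheory GRing.Theory Num.Theory.
Import ComplexField.

Local Open Scope classical_set_scope.
Local Open Scope ring_scope.
Local Open Scope sesquilinear_scope.

(* R[i] is the field of complex numbers over R; [Normc.normc : R[i] -> R] is
   the R-valued modulus (the generic `|z| takes its values in R[i]).  The
   conjugate transpose of M is [M ^t*]. *)

(* On column vectors ('cV) this is the Euclidean norm. *)
Definition frob_norm (R : realType) (m n : nat) (M : 'M[R[i]]_(m, n)) : R :=
  Num.sqrt (\sum_i \sum_j Normc.normc (M i j) ^+ 2).

Definition spectral_norm (R : realType) (m n : nat) (M : 'M[R[i]]_(m, n)) : R :=
  sup [set frob_norm (M *m x) | x in [set x : 'cV[R[i]]_n | frob_norm x = 1]].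

Record is_matrix_norm (R : realType) (n : nat) (N : 'M[R[i]]_n -> R) : Prop :=
  IsMatrixNorm {
    mxnorm_ge0 : forall X, 0 <= N X;
    mxnorm_eq0 : forall X, N X = 0 -> X = 0;
    mxnorm_scale : forall (a : R[i]) X, N (a *: X) = Normc.normc a * N X;
    mxnorm_triangle : forall X Y, N (X + Y) <= N X + N Y }.

Definition submultiplicative (R : realType) (n : nat) (N : 'M[R[i]]_n -> R)
  : Prop := forall X Y, N (X *m Y) <= N X * N Y.

Definition diag_part (R : realType) (n : nat) (M : 'M[R[i]]_n) : 'M[R[i]]_n :=
  diag_mx (\row_i M i i).

(* For n >= 2 the set is finite and nonempty, so [inf] is its minimum. *)
Definition sep (R : realType) (n : nat) (D : 'M[R[i]]_n) : R :=
  inf [set Normc.normc (D p.1 p.1 - D p.2 p.2)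
      | p in [set p : 'I_n * 'I_n | p.1 != p.2]].

Definition right_update (R : realType) (n : nat) (Y D : 'M[R[i]]_n)
  : 'M[R[i]]_n :=
  \matrix_(i, j) if i == j then 0 else Y i j / (D j j - D i i).

(* [None] means that the clustered-eigenvalue procedure is called instead;
   [Some] is the output of the simple-eigenvalue branch. *)
Definition lr_refine (R : realType) (n : nat) (tau : R)
    (A Vhat What Dhat : 'M[R[i]]_n)
  : option ('M[R[i]]_n * 'M[R[i]]_n * 'M[R[i]]_n) :=
  let Res := A *m Vhat - Vhat *m Dhat in
  let Y := What ^t* *m Res in
  let Dt := diag_mx (\row_i (Dhat i i + Y i i)) in
  if sep Dt < tau then None
  else
    let E := right_update Y Dt in
    let FH := 1%:M - What ^t* *m Vhat - E in
    let F := FH ^t* in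
    Some (Vhat *m (1%:M + E), What *m (1%:M + F), Dt).

(* Main.v *)
Require Import Defs.
From mathcomp Require Import ring lra.
Import Order.TTheory GRing.Theory Num.Theory.
Local Open Scope ring_scope.
Local Open Scope sesquilinear_scope.

(** In the coordinates of the approximate eigenvectors [Vhat], the matrix [A]
    becomes [Dhat + Ystar], and the refinement is one linearised step towards
    diagonalising it.  The update [E] is chosen to solve the Sylvester equation
    [E *m D - D *m E = Y - diag_part Y], where [D] already contains the
    diagonal of [Y] ([right_update_sylvester]).  With [Y := YW] and [D := Dt],
    all first-order terms of the updated right residual cancel except
    [Ystar - YW], and what remains is exactly
      [(Ystar - YW) + (Ystar - diag_part YW) *m E]
    ([updated_residualE]).  The second term is a product of two small factors:
    [Ystar - diag_part YW] is the off-diagonal part of [Ystar] plus the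
    diagonal of [Ystar - YW], and [E] is [YW] divided entrywise by eigenvalue
    gaps.

    The gaps are controlled by a perturbation argument: [Dt] and [Dstar]
    differ by the diagonal of [YW - Ystar], so each gap moves by at most
    [2 * eta <= gamma / 2] ([sep_perturb]).  The same estimate, applied to
    quotients, compares the two updates ([right_update_perturb]).

    The left update is a Newton step for the inverse.  Writing [X] for the
    biorthogonality error, it multiplies [1 + X] by [1 - X - E] on the left and
    by [1 + E] on the right; the linear terms cancel, leaving quadratic and
    cubic terms in [E] and [X] only ([left_right_defectE]).

    For the asymptotic statement, [YW - Ystar = Delta *m Ystar], so that [eta]
    is quadratic in [Ystar] as soon as [Delta] is of the order of [Ystar].  The
    bounds above then give the rate, the norms being compared with explicit
    constants that depend on [n] and on the given norm only
    ([frob_norm_le_spectral], [mxnorm_le_frob]). *)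

Notation normc := Normc.normc.
Set Implicit Arguments.
Unset Strict Implicit.
Unset Printing Implicit Defensive.

(** * The real-valued complex modulus *)

Lemma normc_ge0 (R : realType) (x : R[i]) : 0 <= normc x.
Proof. by case: x => a b; apply: sqrtr_ge0. Qed.

(** The additive properties of the modulus are available for the type
    [Rcomplex R], an alias of [R[i]] carrying another algebraic structure; they
    are transported here to [R[i]] itself so that they rewrite there. *)
Lemma normcN (R : realType) (x : R[i]) : normc (- x) = normc x.
Proof. exact: complex.normcN. Qed.

Lemma normcD (R : realType) (x y : R[i]) : normc (x + y) <= normc x + normc y.
Proof. exact: le_normcD. Qed.

Lemma normcB (R : realType) (x y : R[i]) : normc (x - y) <= normc x + normc y.
Proof. by rewrite -[normc y]normcN normcD. Qed.

Lemma normc_sum (R : realType) (I : finType) (F : I -> R[i]) :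
  normc (\sum_i F i) <= \sum_i normc (F i).
Proof.
apply: (big_ind2 (fun x y => normc x <= y)) => //.
- by rewrite Normc.normc0.
- by move=> x1 y1 x2 y2 h1 h2; apply: (le_trans (normcD _ _)); exact: lerD.
Qed.

(** * Cauchy-Schwarz and Minkowski inequalities for finite sums *)

Lemma sum_sqr_ge0 (R : realType) (I : finType) (a : I -> R) :
  0 <= \sum_i a i ^+ 2.
Proof. by apply: sumr_ge0 => i _; exact: sqr_ge0. Qed.

(** Lagrange's identity: the difference of the two sides is half of the sum of
    the squares [(a i * b j - a j * b i) ^+ 2]. *)
Lemma cauchy_schwarz_sum (R : realType) (I : finType) (a b : I -> R) :
  (\sum_i a i * b i) ^+ 2 <= (\sum_i a i ^+ 2) * (\sum_i b i ^+ 2).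
Proof.
have : 0 <= \sum_i \sum_j (a i * b j - a j * b i) ^+ 2.
  by apply: sumr_ge0 => i _; apply: sum_sqr_ge0.
have -> : \sum_i \sum_j (a i * b j - a j * b i) ^+ 2
    = 2 * ((\sum_i a i ^+ 2) * (\sum_i b i ^+ 2)) - 2 * (\sum_i a i * b i) ^+ 2.
  have eqs : \sum_i \sum_j (a i * b j - a j * b i) ^+ 2
      = \sum_i \sum_j (a i ^+ 2 * b j ^+ 2)
        + \sum_i \sum_j (b i ^+ 2 * a j ^+ 2)
        - 2 * \sum_i \sum_j (a i * b i * (a j * b j)).
    rewrite mulr_sumr -sumrN -!big_split; apply: eq_bigr => i _.
    rewrite mulr_sumr -sumrN -!big_split; apply: eq_bigr => j _ /=; ring.
  by rewrite eqs -!big_distrlr /=; ring.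
lra.
Qed.

Lemma minkowski_sum (R : realType) (I : finType) (a b : I -> R) :
  Num.sqrt (\sum_i (a i + b i) ^+ 2)
    <= Num.sqrt (\sum_i a i ^+ 2) + Num.sqrt (\sum_i b i ^+ 2).
Proof.
have sab : \sum_i a i * b i
    <= Num.sqrt (\sum_i a i ^+ 2) * Num.sqrt (\sum_i b i ^+ 2).
  rewrite -sqrtrM ?sum_sqr_ge0 //.
  apply: le_trans (ler_norm _) _.
  by rewrite -sqrtr_sqr ler_wsqrtr // cauchy_schwarz_sum.
rewrite -[leRHS]ger0_norm ?addr_ge0 ?sqrtr_ge0 // -sqrtr_sqr ler_wsqrtr //.
rewrite sqrrD !sqr_sqrtr ?sum_sqr_ge0 //.
have -> : \sum_i (a i + b i) ^+ 2
    = \sum_i a i ^+ 2 + 2 * (\sum_i a i * b i) + \sum_i b i ^+ 2.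
  rewrite mulr_sumr -!big_split; apply: eq_bigr => i _ /=; ring.
lra.
Qed.

(** * The Frobenius norm *)

Lemma frob_normE (R : realType) (m n : nat) (M : 'M[R[i]]_(m, n)) :
  frob_norm M = Num.sqrt (\sum_(p : 'I_m * 'I_n) normc (M p.1 p.2) ^+ 2).
Proof. by rewrite /frob_norm pair_big. Qed.

Lemma frob_norm_ge0 (R : realType) (m n : nat) (M : 'M[R[i]]_(m, n)) :
  0 <= frob_norm M.
Proof. exact: sqrtr_ge0. Qed.

Lemma frob_norm_sqr (R : realType) (m n : nat) (M : 'M[R[i]]_(m, n)) :
  frob_norm M ^+ 2 = \sum_i \sum_j normc (M i j) ^+ 2.
Proof. by rewrite sqr_sqrtr // sumr_ge0 // => i _; exact: sum_sqr_ge0. Qed.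

(** Every Frobenius estimate of an entrywise quotient goes through this
    comparison, the factor [c] bounding the inverse gaps. *)
Lemma frob_norm_scale_le (R : realType) (m n : nat) (c : R)
    (M P : 'M[R[i]]_(m, n)) :
  0 <= c -> (forall i j, normc (M i j) <= c * normc (P i j)) ->
  frob_norm M <= c * frob_norm P.
Proof.
move=> c0 h; rewrite -[c]ger0_norm // -sqrtr_sqr -sqrtrM ?sqr_ge0 //.
apply: ler_wsqrtr; rewrite mulr_sumr; apply: ler_sum => i _.
rewrite mulr_sumr; apply: ler_sum => j _; rewrite -exprMn.
by rewrite lerXn2r ?nnegrE ?mulr_ge0 ?normc_ge0.
Qed.

Lemma frob_norm_le (R : realType) (m n : nat) (M P : 'M[R[i]]_(m, n)) :
  (forall i j, normc (M i j) <= normc (P i j)) -> frob_norm M <= frob_norm P.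
Proof.
move=> h; rewrite -[leRHS]mul1r; apply: frob_norm_scale_le => // i j.
by rewrite mul1r.
Qed.

Lemma frob_normN (R : realType) (m n : nat) (M : 'M[R[i]]_(m, n)) :
  frob_norm (- M) = frob_norm M.
Proof. by apply/eqP; rewrite eq_le !frob_norm_le // => i j; rewrite mxE normcN. Qed.

Lemma frob_normD (R : realType) (m n : nat) (M P : 'M[R[i]]_(m, n)) :
  frob_norm (M + P) <= frob_norm M + frob_norm P.
Proof.
rewrite !frob_normE; apply: le_trans (minkowski_sum _ _).
apply: ler_wsqrtr; apply: ler_sum => p _.
by rewrite lerXn2r ?nnegrE ?addr_ge0 ?normc_ge0 // mxE normcD.
Qed.

(** Cauchy-Schwarz, applied to each entry of the product. *)
Lemma frob_normM (R : realType) (m n p : nat) (M : 'M[R[i]]_(m, n))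
    (P : 'M[R[i]]_(n, p)) :
  frob_norm (M *m P) <= frob_norm M * frob_norm P.
Proof.
rewrite -ler_sqr ?nnegrE ?mulr_ge0 ?frob_norm_ge0 // exprMn !frob_norm_sqr.
rewrite [X in _ * X]exchange_big big_distrlr /=.
apply: ler_sum => i _; apply: ler_sum => j _.
apply: le_trans (cauchy_schwarz_sum _ _).
rewrite lerXn2r ?nnegrE ?normc_ge0 ?sumr_ge0 //.
  by move=> k _; rewrite mulr_ge0 ?normc_ge0.
rewrite mxE (le_trans (normc_sum _)) //.
by apply: ler_sum => k _; rewrite Normc.normcM.
Qed.

Lemma normc_le_frob_norm (R : realType) (m n : nat) (M : 'M[R[i]]_(m, n)) i j :
  normc (M i j) <= frob_norm M.
Proof.
rewrite -ler_sqr ?nnegrE ?normc_ge0 ?frob_norm_ge0 // frob_norm_sqr.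
rewrite (bigD1 i) //= (bigD1 j) //= -addrA lerDl addr_ge0 // sumr_ge0 //.
  by move=> k _; exact: sqr_ge0.
by move=> k _; exact: sum_sqr_ge0.
Qed.

(** * Comparison of norms *)

(** The set of lengths [frob_norm (M *m x)] is bounded above by [frob_norm M],
    and only for that reason does its supremum bound each of them. *)
Lemma spectral_norm_ub (R : realType) (m n : nat) (M : 'M[R[i]]_(m, n))
    (x : 'cV[R[i]]_n) :
  frob_norm x = 1 -> frob_norm (M *m x) <= spectral_norm M.
Proof.
move=> x1; apply: ub_le_sup; last by exists x.
exists (frob_norm M) => _ [y /= y1 <-].
by apply: le_trans (frob_normM _ _) _; rewrite y1 mulr1.
Qed.

(** Each of the [n] columns of [M] is the image of a unit vector, hence has
    length at most the spectral norm. *)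
Lemma frob_norm_le_spectral (R : realType) (m n : nat) (M : 'M[R[i]]_(m, n)) :
  frob_norm M <= Num.sqrt n%:R * spectral_norm M.
Proof.
have col_le j : frob_norm (col j M) <= spectral_norm M.
  rewrite colE; apply: spectral_norm_ub.
  rewrite /frob_norm (bigD1 j) //= big_ord1 mxE !eqxx Normc.normc1 expr1n.
  rewrite big1 ?addr0 ?sqrtr1 // => k kj.
  by rewrite big_ord1 mxE (negbTE kj) Normc.normc0 expr0n.
(* Nonnegativity of the spectral norm is read off a column, if there is
   one; without columns both sides vanish. *)
case: n M col_le => [|n] M col_le.
  rewrite sqrtr0 mul0r /frob_norm big1 ?sqrtr0 // => i _.
  by rewrite big_ord0.
have s0 : 0 <= spectral_norm M.
  exact: le_trans (frob_norm_ge0 _) (col_le ord0).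
rewrite -ler_sqr ?nnegrE ?mulr_ge0 ?frob_norm_ge0 ?sqrtr_ge0 //.
rewrite frob_norm_sqr exchange_big /= exprMn sqr_sqrtr ?ler0n //.
rewrite -[X in X%:R]card_ord mulr_natl -sumr_const; apply: ler_sum => j _.
apply: le_trans (_ : frob_norm (col j M) ^+ 2 <= _).
  rewrite frob_norm_sqr; apply: ler_sum => i _.
  by rewrite big_ord1 mxE.
by rewrite lerXn2r ?nnegrE ?frob_norm_ge0.
Qed.

Lemma mxnorm0 (R : realType) (n : nat) (N : 'M[R[i]]_n -> R) :
  is_matrix_norm N -> N 0 = 0.
Proof. by move=> hN; rewrite -(scale0r 0) (mxnorm_scale hN) Normc.normc0 mul0r. Qed.

Lemma mxnormN (R : realType) (n : nat) (N : 'M[R[i]]_n -> R) X :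
  is_matrix_norm N -> N (- X) = N X.
Proof.
by move=> hN; rewrite -scaleN1r (mxnorm_scale hN) normcN Normc.normc1 mul1r.
Qed.

(** The easy half of the equivalence of norms in finite dimension: expand [X] in
    the canonical basis and bound each entry by [frob_norm X]. *)
Lemma mxnorm_le_frob (R : realType) (n : nat) (N : 'M[R[i]]_n -> R) X :
  is_matrix_norm N ->
  N X <= (\sum_i \sum_j N (delta_mx i j)) * frob_norm X.
Proof.
move=> hN; have Nsum (I : finType) (F : I -> 'M[R[i]]_n) :
    N (\sum_i F i) <= \sum_i N (F i).
  apply: (big_ind2 (fun X y => N X <= y)) => //; first by rewrite mxnorm0.
  by move=> X1 y1 X2 y2 h1 h2; apply: le_trans (mxnorm_triangle hN _ _) (lerD h1 h2).
rewrite {1}(matrix_sum_delta X) mulr_suml; apply: le_trans (Nsum _ _) _.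
apply: ler_sum => i _; rewrite mulr_suml; apply: le_trans (Nsum _ _) _.
apply: ler_sum => j _; rewrite (mxnorm_scale hN) mulrC.
by rewrite ler_wpM2l ?(mxnorm_ge0 hN) ?normc_le_frob_norm.
Qed.

(** * Separation of diagonals *)

Lemma sep_le (R : realType) (n : nat) (D : 'M[R[i]]_n) i j :
  i != j -> sep D <= normc (D i i - D j j).
Proof.
move=> ij; apply: ge_inf; last by exists (i, j).
by exists 0 => _ [p _ <-]; exact: normc_ge0.
Qed.

Lemma le_sep (R : realType) (n : nat) (D : 'M[R[i]]_n) (x : R) :
  (1 < n)%N -> (forall i j, i != j -> x <= normc (D i i - D j j)) ->
  x <= sep D.
Proof.
move=> n1 h; apply: lb_le_inf; last by move=> _ [[i j] /= ij <-]; exact: h.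
have n0 : (0 < n)%N by exact: ltnW.
by eexists; exists (Ordinal n0, Ordinal n1).
Qed.

Lemma normc_diag_gap_sub (R : realType) (n : nat) (D D' : 'M[R[i]]_n) i j :
  normc ((D i i - D j j) - (D' i i - D' j j)) <= 2 * frob_norm (D - D').
Proof.
have -> : (D i i - D j j) - (D' i i - D' j j) = (D - D') i i - (D - D') j j.
  by rewrite !mxE; ring.
apply: le_trans (normcB _ _) _; rewrite mulr_natl mulr2n.
by apply: lerD; exact: normc_le_frob_norm.
Qed.

(** The subtracted term is [2 * frob_norm] because a gap involves two diagonal
    entries, each moving by at most the Frobenius norm of the perturbation. *)
Lemma sep_perturb (R : realType) (n : nat) (D D' : 'M[R[i]]_n) i j :
  i != j -> sep D - 2 * frob_norm (D' - D) <= normc (D' i i - D' j j).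
Proof.
move=> ij; have h := normc_diag_gap_sub D' D i j.
have s := sep_le D ij.
have t := normcB (D' i i - D' j j) (D' i i - D' j j - (D i i - D j j)).
rewrite opprB addrC subrK in t.
lra.
Qed.

(** * Diagonal and off-diagonal parts *)

Lemma frob_norm_diag_part (R : realType) (n : nat) (M : 'M[R[i]]_n) :
  frob_norm (diag_part M) <= frob_norm M.
Proof.
apply: frob_norm_le => i j; rewrite !mxE.
by case: eqVneq => [->|_]; rewrite ?mulr1n // mulr0n Normc.normc0 normc_ge0.
Qed.

Lemma frob_norm_offdiag_part (R : realType) (n : nat) (M : 'M[R[i]]_n) :
  frob_norm (M - diag_part M) <= frob_norm M.
Proof.
apply: frob_norm_le => i j; rewrite !mxE.
by case: eqVneq => [->|_]; rewrite ?mulr1n ?subrr ?Normc.normc0 ?normc_ge0 ?subr0.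
Qed.

Lemma diag_partB (R : realType) (n : nat) (M P : 'M[R[i]]_n) :
  diag_part (M - P) = diag_part M - diag_part P.
Proof. by apply/matrixP => i j; rewrite !mxE mulrnBl. Qed.

(** * The right update *)

Lemma frob_norm_right_update (R : realType) (n : nat) (g : R)
    (Y D : 'M[R[i]]_n) :
  0 < g -> (forall i j, i != j -> g <= normc (D i i - D j j)) ->
  frob_norm (right_update Y D) <= g^-1 * frob_norm Y.
Proof.
move=> g0 h; apply: frob_norm_scale_le; first by rewrite invr_ge0 ltW.
move=> i j; rewrite mxE; case: eqVneq => [->|ij].
  by rewrite Normc.normc0 mulr_ge0 ?normc_ge0 // invr_ge0 ltW.
rewrite Normc.normcM Normc.normcV mulrC ler_wpM2r ?normc_ge0 //.
have gD := h j i; rewrite eq_sym in gD; have {}gD := gD ij.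
by rewrite lef_pV2 ?posrE // (lt_le_trans g0).
Qed.

(** Entry [(i, j)] of the commutator is [E i j * (D j j - D i i)], and
    [right_update] divides by precisely this gap; the diagonal of a commutator
    with a diagonal matrix vanishes, so only the off-diagonal part of [Y] can be
    reproduced. *)
Lemma right_update_sylvester (R : realType) (n : nat) (Y D : 'M[R[i]]_n) :
  is_diag_mx D -> (forall i j, i != j -> D i i != D j j) ->
  right_update Y D *m D - D *m right_update Y D = Y - diag_part Y.
Proof.
move=> /is_diag_mxP Dd neqD; apply/matrixP => i j; rewrite !mxE.
rewrite (bigD1 j) //= big1 ?addr0; last first.
  by move=> k kj; rewrite (Dd k j) ?mulr0.
rewrite (bigD1 i) //= big1 ?addr0; last first.
  by move=> k ki; rewrite (Dd i k) ?mul0r // eq_sym.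
rewrite mxE; case: eqVneq => [->|ij]; first by rewrite mulr1n; ring.
rewrite mulr0n subr0 [D i i * _]mulrC -mulrBr divfK // subr_eq0 eq_sym neqD //.
Qed.

(** With [d], [d'] the two gaps, [y' / d' - y / d] splits as
    [(y' - y) / d' + y * (d - d') / (d' * d)].  The first part is a right update
    with the gap bound [g / 2]; in the second, [d * d'] is at least
    [g ^+ 2 / 2] and [d - d'] at most [2 * frob_norm (D' - D)]. *)
Lemma right_update_perturb (R : realType) (n : nat) (g : R)
    (Y Y' D D' : 'M[R[i]]_n) :
  0 < g -> (forall i j, i != j -> g <= normc (D i i - D j j)) ->
  (forall i j, i != j -> g / 2 <= normc (D' i i - D' j j)) ->
  frob_norm (right_update Y' D' - right_update Y D)
    <= 2 / g * frob_norm (Y' - Y)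
       + 4 / g ^+ 2 * frob_norm Y * frob_norm (D' - D).
Proof.
move=> g0 hD hD'.
have gap0 (M : 'M[R[i]]_n) (e : R) i j : 0 < e -> e <= normc (M i i - M j j) ->
    M i i - M j j != 0.
  by move=> e0; apply: contraTneq => ->; rewrite Normc.normc0 -ltNge.
have g20 : 0 < g / 2 by rewrite divr_gt0.
pose P := \matrix_(i, j) (if i == j then 0 else
  Y i j * ((D j j - D i i) - (D' j j - D' i i))
    / ((D' j j - D' i i) * (D j j - D i i))) : 'M[R[i]]_n.
have -> : right_update Y' D' - right_update Y D
    = right_update (Y' - Y) D' + P.
  apply/matrixP => i j; rewrite !mxE; case: eqVneq => [_|ij].
    by rewrite subr0 addr0.
  rewrite eq_sym in ij.
  have := gap0 D' _ _ _ g20 (hD' _ _ ij); have := gap0 D _ _ _ g0 (hD _ _ ij).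
  by move=> d0 d0'; field; rewrite d0 d0'.
apply: le_trans (frob_normD _ _) _; apply: lerD.
  by rewrite -[2 / g]invf_div; apply: frob_norm_right_update.
rewrite mulrAC; apply: frob_norm_scale_le.
  by rewrite !mulr_ge0 ?frob_norm_ge0 ?invr_ge0 ?exprn_ge0 // ltW.
move=> i j; rewrite mxE; case: eqVneq => [_|ij].
  rewrite Normc.normc0 !mulr_ge0 ?normc_ge0 ?frob_norm_ge0 //.
  by rewrite invr_ge0 exprn_ge0 // ltW.
rewrite eq_sym in ij.
rewrite -mulrA mulrC Normc.normcM ler_wpM2r ?normc_ge0 //.
rewrite Normc.normcM Normc.normcV Normc.normcM.
have -> : 4 / g ^+ 2 * frob_norm (D' - D)
   = 2 * frob_norm (D' - D) * (g / 2 * g)^-1 by field; rewrite lt0r_neq0.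
apply: ler_pM; rewrite ?normc_ge0 ?invr_ge0 ?mulr_ge0 ?normc_ge0 //.
  by rewrite -normcN opprB normc_diag_gap_sub.
have ht := ler_pM (ltW g20) (ltW g0) (hD' _ _ ij) (hD _ _ ij).
have p0 := mulr_gt0 g20 g0.
by rewrite lef_pV2 // posrE // (lt_le_trans p0).
Qed.

(** * Exact error formulas *)

(** In the coordinates of [V], the residual is
    [(Ystar + Dhat) *m (1 + E) - (1 + E) *m D].  Replacing [Dhat] by
    [D - diag_part Y] and [E *m D] by its value in the Sylvester equation
    removes the off-diagonal part of [Y]. *)
Lemma updated_residualE (R : realType) (n : nat)
    (A V Dhat D Y : 'M[R[i]]_n) :
  V \in unitmx -> is_diag_mx D -> (forall i j, i != j -> D i i != D j j) ->
  D = Dhat + diag_part Y ->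
  let Ystar := invmx V *m (A *m V - V *m Dhat) in
  let E := right_update Y D in
  let Vt := V *m (1%:M + E) in
  invmx V *m (A *m Vt - Vt *m D)
    = (Ystar - Y) + (Ystar - diag_part Y) *m E.
Proof.
move=> Vu Dd Dn DE Ystar E Vt.
have sy : E *m D = D *m E + (Y - diag_part Y).
  by rewrite -(right_update_sylvester _ Dd Dn) [RHS]addrC subrK.
have -> : invmx V *m (A *m Vt - Vt *m D)
    = (invmx V *m (A *m V)) *m (1%:M + E) - (1%:M + E) *m D.
  by rewrite mulmxBr /Vt -!mulmxA mulKmx.
have -> : invmx V *m (A *m V) = Ystar + Dhat.
  by rewrite /Ystar mulmxBr mulKmx // subrK.
have -> : Dhat = D - diag_part Y by rewrite DE addrK.
rewrite mulmxDr mulmx1 [X in _ - X]mulmxDl mul1mx sy.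
rewrite !mulmxDl !mulNmx.
move: (Ystar *m E) (D *m E) (diag_part Y *m E) => a b c.
apply/matrixP => i j; rewrite !mxE; ring.
Qed.

(** [1 + (1 - G - E)] is [1 - (X + E)], the first-order inverse of
    [(1 + X) *m (1 + E)]: the product differs from [1] by terms of order at
    least two. *)
Lemma left_right_defectE (R : realType) (n : nat) (G X E : 'M[R[i]]_n) :
  X = G - 1%:M ->
  (1%:M + (1%:M - G - E)) *m G *m (1%:M + E) - 1%:M
    = - (E *m E + E *m X + X *m X) - (X + E) *m (X *m E).
Proof.
move=> XE; have -> : G = 1%:M + X by rewrite XE addrC subrK.
have -> : 1%:M + (1%:M - (1%:M + X) - E) = 1%:M - (X + E).
  by apply/matrixP => i j; rewrite !mxE; ring.
rewrite !(mulmxDl, mulmxDr, mulNmx, mulmxN, mul1mx, mulmx1, mulmxA).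
move: (X *m X *m E) (E *m X *m E) (X *m X) (E *m X) (X *m E) (E *m E).
move=> a b c d e f; apply/matrixP => i j; rewrite !mxE; ring.
Qed.

(** * The refinement step *)

Lemma lr_refine_SomeE (R : realType) (n : nat) (tau : R)
    (A Vhat What Dhat Vt Wt Dt : 'M[R[i]]_n) :
  is_diag_mx Dhat -> lr_refine tau A Vhat What Dhat = Some (Vt, Wt, Dt) ->
  let YW := What ^t* *m (A *m Vhat - Vhat *m Dhat) in
  let EW := right_update YW Dt in
  [/\ Dt = Dhat + diag_part YW, Vt = Vhat *m (1%:M + EW)
    & Wt ^t* = (1%:M + (1%:M - What ^t* *m Vhat - EW)) *m What ^t*].
Proof.
move=> /is_diag_mxP Dd; rewrite /lr_refine; case: ifP => // _ [<- <- <-] /=.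
split=> //.
  apply/matrixP => i j; rewrite !mxE.
  by case: eqVneq => [->|/(Dd _ _) ->]; rewrite ?mulr1n ?mulr0n ?addr0.
rewrite trmx_mul map_mxM /= raddfD /= map_mxD /= trmx1 map_mx1; congr (_ *m _).
by rewrite trmxCK.
Qed.

(** The quadratic terms contain [E *m X] but not [X *m E], so they are within
    [(N E + N X) ^+ 2]; the cubic term needs [x * e <= (e + x) ^+ 2]. *)
Lemma biorthogonality_le (R : realType) (n : nat) (N : 'M[R[i]]_n -> R)
    (E X : 'M[R[i]]_n) :
  is_matrix_norm N -> submultiplicative N ->
  N (- (E *m E + E *m X + X *m X) - (X + E) *m (X *m E))
    <= (N E + N X) ^+ 2 + (N E + N X) ^+ 3.
Proof.
move=> hN sN; have N0 := mxnorm_ge0 hN; have ND := mxnorm_triangle hN.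
have cubic : N ((X + E) *m (X *m E)) <= (N X + N E) * (N X * N E).
  by apply: le_trans (sN _ _) (ler_pM _ _ (ND _ _) (sN _ _)).
have := ND (- (E *m E + E *m X + X *m X)) (- ((X + E) *m (X *m E))).
rewrite !(mxnormN _ hN).
have := ND (E *m E + E *m X) (X *m X); have := ND (E *m E) (E *m X).
have := sN E E; have := sN E X; have := sN X X; have := N0 E; have := N0 X.
move: cubic; move: (N E) (N X) => e x; move=> c x0 e0 xx ex ee h1 h2 h3.
have ex0 : 0 <= e * x by rewrite mulr_ge0.
have : (x + e) * (x * e) <= (e + x) ^+ 3.
  rewrite -subr_ge0.
  have -> : (e + x) ^+ 3 - (x + e) * (x * e)
    = (e + x) * (e * e + e * x + x * x) by ring.
  by rewrite mulr_ge0 ?addr_ge0 ?mulr_ge0.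
rewrite sqrrD -mulr_natl !expr2; lra.
Qed.

(** Common source of the finite estimates and of the asymptotic ones.  The
    second bound, on the update itself, is what turns the biorthogonality
    estimate into a quadratic rate. *)
Lemma simple_branch_bounds (R : realType) (n : nat) (tau : R)
    (A Vhat What Dhat Vt Wt Dt : 'M[R[i]]_n) :
  Vhat \in unitmx -> is_diag_mx Dhat ->
  let Res := A *m Vhat - Vhat *m Dhat in
  let Delta := What ^t* *m Vhat - 1%:M in
  let Ystar := invmx Vhat *m Res in
  let YW := What ^t* *m Res in
  let gamma := sep (Dhat + diag_part Ystar) in
  let eta := frob_norm (YW - Ystar) in
  let EW := right_update YW Dt in
  0 < gamma -> eta <= gamma / 4 ->
  lr_refine tau A Vhat What Dhat = Some (Vt, Wt, Dt) ->
  [/\ forall i j, i != j -> gamma / 2 <= normc (Dt i i - Dt j j),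
      frob_norm EW <= 2 / gamma * (frob_norm Ystar + eta),
      frob_norm (invmx Vhat *m (A *m Vt - Vt *m Dt))
        <= eta + 2 * (frob_norm Ystar + eta) ^+ 2 / gamma
    & forall N : 'M[R[i]]_n -> R, is_matrix_norm N -> submultiplicative N ->
        N (Wt ^t* *m Vt - 1%:M)
          <= (N EW + N Delta) ^+ 2 + (N EW + N Delta) ^+ 3].
Proof.
move=> Vu Dd Res Delta Ystar YW gamma eta EW g0 eg.
case/(lr_refine_SomeE Dd); rewrite -/Res -/YW -/EW => DtE VtE WtE.
have gap i j : i != j -> gamma / 2 <= normc (Dt i i - Dt j j).
  move=> ij; apply: le_trans (sep_perturb (Dhat + diag_part Ystar) Dt ij).
  have -> : Dt - (Dhat + diag_part Ystar) = diag_part (YW - Ystar).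
    by rewrite DtE diag_partB opprD addrACA subrr add0r.
  have := frob_norm_diag_part (YW - Ystar); rewrite -/eta -/gamma; lra.
have g20 : 0 < gamma / 2 by rewrite divr_gt0.
have neqD i j : i != j -> Dt i i != Dt j j.
  move=> /gap; rewrite -subr_eq0; apply: contraTneq => ->.
  by rewrite Normc.normc0 -ltNge.
have diagDt : is_diag_mx Dt.
  apply/is_diag_mxP => i j ij; rewrite DtE !mxE (is_diag_mxP Dd) //.
  by rewrite -val_eqE /= (negbTE ij) mulr0n addr0.
have YWle : frob_norm YW <= frob_norm Ystar + eta.
  by rewrite -[YW in leLHS](subrK Ystar) addrC; apply: frob_normD.
have EWle : frob_norm EW <= 2 / gamma * (frob_norm Ystar + eta).
  apply: le_trans (frob_norm_right_update YW g20 gap) _.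
  by rewrite invf_div ler_wpM2l // divr_ge0 // ltW.
split=> //.
  rewrite VtE (updated_residualE A Vu diagDt neqD DtE) -/Res -/Ystar -/EW.
  apply: le_trans (frob_normD _ _) _; apply: lerD.
    by rewrite -frob_normN opprB.
  apply: le_trans (frob_normM _ _) _.
  have -> : 2 * (frob_norm Ystar + eta) ^+ 2 / gamma
    = (frob_norm Ystar + eta) * (2 / gamma * (frob_norm Ystar + eta)) by ring.
  apply: ler_pM; rewrite ?frob_norm_ge0 //.
  (* Only the off-diagonal entries of [Ystar] survive at full size: on the
     diagonal the updated [Dt] leaves the difference [Ystar - YW]. *)
  have -> : Ystar - diag_part YW
      = (Ystar - diag_part Ystar) + diag_part (Ystar - YW).
    by rewrite diag_partB addrA subrK.
  apply: le_trans (frob_normD _ _) (lerD (frob_norm_offdiag_part _) _).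
  apply: le_trans (frob_norm_diag_part _) _.
  by rewrite -frob_normN opprB.
move=> N hN sN; rewrite WtE VtE mulmxA -[X in X *m _ - _]mulmxA.
by rewrite (left_right_defectE _ (erefl Delta)) biorthogonality_le.
Qed.

Theorem theorem4 (R : realType) (n : nat) (hn : (1 < n)%N) :
  (forall A Vhat What Dhat : 'M[R[i]]_n,
     Vhat \in unitmx -> is_diag_mx Dhat ->
     let Res := A *m Vhat - Vhat *m Dhat in
     let Delta := What ^t* *m Vhat - 1%:M in
     let Ystar := invmx Vhat *m Res in
     let YW := What ^t* *m Res in
     let Dstar := Dhat + diag_part Ystar in
     let Dt := Dhat + diag_part YW in
     let gamma := sep Dstar in
     let eta := frob_norm (YW - Ystar) in
     let Estar := right_update Ystar Dstar in
     let EW := right_update YW Dt in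
     0 < gamma -> eta <= gamma / 4 ->
     forall (tau : R) (Vt Wt : 'M[R[i]]_n),
     0 < tau ->
     lr_refine tau A Vhat What Dhat = Some (Vt, Wt, Dt) ->
     [/\ gamma / 2 <= sep Dt,
         frob_norm (EW - Estar)
           <= (2 / gamma + 4 * frob_norm Ystar / gamma ^+ 2) * eta,
         frob_norm (invmx Vhat *m (A *m Vt - Vt *m Dt))
           <= eta + 2 * (frob_norm Ystar + eta) ^+ 2 / gamma
       & forall N : 'M[R[i]]_n -> R,
           is_matrix_norm N -> submultiplicative N ->
           N (Wt ^t* *m Vt - 1%:M)
             <= (N EW + N Delta) ^+ 2 + (N EW + N Delta) ^+ 3])
  /\
  (forall N : 'M[R[i]]_n -> R,
     is_matrix_norm N -> submultiplicative N ->
     forall C gamma0 : R, 0 < C -> 0 < gamma0 ->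
     exists K eps : R, [/\ 0 < K, 0 < eps &
       forall A Vhat What Dhat : 'M[R[i]]_n,
         Vhat \in unitmx -> is_diag_mx Dhat ->
         let Res := A *m Vhat - Vhat *m Dhat in
         let Delta := What ^t* *m Vhat - 1%:M in
         let Ystar := invmx Vhat *m Res in
         let YW := What ^t* *m Res in
         let gamma := sep (Dhat + diag_part Ystar) in
         let eta := frob_norm (YW - Ystar) in
         eta <= gamma / 4 -> gamma0 <= gamma ->
         spectral_norm Delta <= C * frob_norm Ystar ->
         frob_norm Ystar <= eps ->
         forall (tau : R) (Vt Wt Dt : 'M[R[i]]_n),
         0 < tau ->
         lr_refine tau A Vhat What Dhat = Some (Vt, Wt, Dt) ->
         frob_norm (invmx Vhat *m (A *m Vt - Vt *m Dt))
           <= K * frob_norm Ystar ^+ 2 /\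
         N (Wt ^t* *m Vt - 1%:M) <= K * frob_norm Ystar ^+ 2]).
Proof.
split.
  move=> A Vhat What Dhat Vu Dd Res Delta Ystar YW Dstar Dt gamma eta Estar EW.
  move=> g0 eg tau Vt Wt _ run.
  have [gap _ res bio] := simple_branch_bounds Vu Dd g0 eg run.
  split; [exact: le_sep| |exact: res|exact: bio].
  apply: le_trans (right_update_perturb Ystar YW g0 (sep_le Dstar) gap) _.
  have Dle : frob_norm (Dt - Dstar) <= eta.
    have -> : Dt - Dstar = diag_part (YW - Ystar).
      by rewrite diag_partB /Dt /Dstar opprD addrACA subrr add0r.
    exact: frob_norm_diag_part.
  rewrite [leRHS]mulrDl lerD2l [4 * _ / _]mulrAC ler_wpM2l //.
  by rewrite mulr_ge0 ?frob_norm_ge0 // divr_ge0 ?exprn_ge0 // ltW.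
move=> N hN sN C gamma0 C0 g00.
pose kN := \sum_i \sum_j N (delta_mx i j).
have kN0 : 0 <= kN.
  by do 2![apply: sumr_ge0 => ? _]; apply: mxnorm_ge0 hN _.
pose c := Num.sqrt n%:R * C.
have c0 : 0 <= c by rewrite mulr_ge0 ?sqrtr_ge0 // ltW.
pose b := kN * (2 / gamma0 * (1 + c) + c).
have b0 : 0 <= b.
  by rewrite mulr_ge0 // addr_ge0 // mulr_ge0 ?divr_ge0 ?addr_ge0 // ltW.
pose r := c + 2 * (1 + c) ^+ 2 / gamma0.
have r0 : 0 <= r by rewrite addr_ge0 // divr_ge0 ?(ltW g00) // mulr_ge0 ?sqr_ge0.
(* For [frob_norm Ystar <= 1], the residual is at most [r] and the
   biorthogonality error at most [b ^+ 2 + b ^+ 3] times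
   [frob_norm Ystar ^+ 2]; the summand [1] makes the constant positive. *)
exists (1 + r + b ^+ 2 + b ^+ 3), 1; split=> //.
  by rewrite !ltr_wpDr ?exprn_ge0.
move=> A Vhat What Dhat Vu Dd Res Delta Ystar YW gamma eta eg gg Dle y1.
move=> tau Vt Wt Dt _ run.
have g0 : 0 < gamma := lt_le_trans g00 gg.
have [_ EWle res bio] := simple_branch_bounds Vu Dd g0 eg run.
set y := frob_norm Ystar in Dle y1 EWle res *.
have y0 : 0 <= y by exact: frob_norm_ge0.
have Dfrob : frob_norm Delta <= c * y.
  apply: le_trans (frob_norm_le_spectral Delta) _.
  by rewrite -mulrA ler_wpM2l ?sqrtr_ge0.
have eta_le : eta <= c * y ^+ 2.
  have -> : eta = frob_norm (Delta *m Ystar).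
    rewrite /eta /YW -[Res in What ^t* *m Res](mulKVmx Vu) -/Ystar.
    by rewrite mulmxA mulmxBl mul1mx.
  apply: le_trans (frob_normM _ _) _.
  by rewrite expr2 mulrA ler_wpM2r.
have yy : y ^+ 2 <= y by rewrite expr2 ler_piMl.
have sum_le : y + eta <= (1 + c) * y.
  by rewrite mulrDl mul1r lerD2l (le_trans eta_le) // ler_wpM2l.
have eta0 : 0 <= eta by exact: frob_norm_ge0.
have gV : gamma^-1 <= gamma0^-1 by rewrite lef_pV2.
have K1 : r <= 1 + r + b ^+ 2 + b ^+ 3.
  have := exprn_ge0 2 b0; have := exprn_ge0 3 b0; lra.
have K2 : b ^+ 2 + b ^+ 3 <= 1 + r + b ^+ 2 + b ^+ 3 by lra.
split.
  apply: le_trans (ler_wpM2r (sqr_ge0 y) K1).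
  apply: le_trans res _; rewrite [r * _]mulrDl; apply: lerD => //.
  have -> : 2 * (1 + c) ^+ 2 / gamma0 * y ^+ 2
    = 2 * ((1 + c) * y) ^+ 2 / gamma0 by ring.
  have sq_le : (y + eta) ^+ 2 <= ((1 + c) * y) ^+ 2.
    by rewrite lerXn2r // nnegrE ?addr_ge0 // (le_trans _ sum_le) ?addr_ge0.
  apply: ler_pM => //; last by rewrite ler_wpM2l.
    by apply: mulr_ge0 => //; exact: sqr_ge0.
  by rewrite invr_ge0 ltW.
apply: le_trans (ler_wpM2r (sqr_ge0 y) K2).
apply: le_trans (bio N hN sN) _.
set E := right_update _ _ in EWle *.
have s0 : 0 <= N E + N Delta by rewrite addr_ge0 ?(mxnorm_ge0 hN).
have s_le : N E + N Delta <= b * y.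
  rewrite /b mulrDr mulrDl; apply: lerD.
    apply: le_trans (mxnorm_le_frob _ hN) _.
    rewrite -/kN -!mulrA ler_wpM2l // (le_trans EWle) // mulrA.
    apply: ler_pM => //; rewrite ?addr_ge0 ?divr_ge0 ?(ltW g0) //.
    by rewrite ler_wpM2l.
  apply: le_trans (mxnorm_le_frob _ hN) _.
  by rewrite -/kN -mulrA ler_wpM2l.
have by0 : 0 <= b * y by rewrite mulr_ge0.
rewrite mulrDl; apply: lerD.
  by rewrite -exprMn lerXn2r ?nnegrE.
apply: le_trans (_ : (b * y) ^+ 3 <= _); first by rewrite lerXn2r ?nnegrE.
by rewrite exprMn ler_wpM2l ?exprn_ge0 // exprSr ler_piMr ?sqr_ge0.
Qed.
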